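(* Let $\lambda\in\mathbb{R}$ and let $r\ge 0$ be an integer. For all integers $p,k$ with $k\ge p\ge 0$, $${k+r \brace p+r}_{r,\lambda}=\sum_{m=p}^{k}\bigg[\binom{k}{m}(-1)^{k-m}\langle 1\rangle_{k-m,\lambda}\bigg({m+1+r\brace p+1+r}_{r,\lambda}-r{m+r \brace p+1+r}_{r,\lambda}\bigg)+\lambda k\binom{k-1}{m}(-1)^{k-m-1}\langle 1\rangle_{k-m-1,\lambda}{m+1+r \brace p+1+r}_{r,\lambda}\bigg].$$
   Context: For $\lambda\in\mathbb{R}$ and $y$ a number or indeterminate, $(y)_{0,\lambda}=1$ and $(y)_{n,\lambda}=y(y-\lambda)(y-2\lambda)\cdots(y-(n-1)\lambda)$ for $n\ge 1$; $\langle y\rangle_{n,\lambda}=(-1)^{n}(-y)_{n,\lambda}$, i.e. $\langle y\rangle_{0,\lambda}=1$ and $\langle y\rangle_{n,\lambda}=y(y+\lambda)\cdots(y+(n-1)\lambda)$ for $n\ge 1$. Also $(y)_{0}=1$ and $(y)_{n}=y(y-1)\cdots(y-n+1)$ for $n\ge1$. For an integer $r\ge 0$, the degenerate $r$-Stirling numbers of the second kind ${n+r \brace k+r}_{r,\lambda}$ ($0\le k\le n$) are defined by the polynomial identity $$(y+r)_{n,\lambda}=\sum_{k=0}^{n}{n+r \brace k+r}_{r,\lambda}(y)_{k}\quad (n\ge 0).$$ Conventions: ${n+r\brace k+r}_{r,\lambda}=0$ if $k>n$; the term containing $k\binom{k-1}{m}\langle 1\rangle_{k-m-1,\lambda}$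 is $0$ when $m=k$ (since $k\binom{k-1}{k}=0$). *)

(* Defs.v *)
From HB Require Import structures.
From mathcomp Require Import all_boot all_order all_algebra.
From mathcomp Require Import reals.
Set Implicit Arguments.
Unset Strict Implicit.
Unset Printing Implicit Defensive.
Import Order.TTheory GRing.Theory Num.Theory.
Local Open Scope ring_scope.

(* (y)_{n,l}; the base ring A is abstract so that y can be either a number or
   an indeterminate (in the latter case A = {poly R} and l is a constant). *)
Definition dfall (A : comNzRingType) (l y : A) (n : nat) : A :=
  \prod_(i < n) (y - i%:R * l).

(* <y>_{n,l} *)
Definition drise (A : comNzRingType) (l y : A) (n : nat) : A :=
  (-1) ^+ n * dfall l (- y) n.

Lemma driseE (A : comNzRingType) (l y : A) n :
  drise l y n = \prod_(i < n) (y + i%:R * l).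
Proof.
rewrite /drise /dfall -[n in _ ^+ n]card_ord -prodr_const -big_split /=.
by apply: eq_bigr => i _; rewrite mulN1r opprB opprK addrC.
Qed.

(* (y)_n *)
Definition fall (A : comNzRingType) (y : A) (n : nat) : A :=
  \prod_(i < n) (y - i%:R).

Section DegenerateRStirling.
Variables (R : comNzRingType) (l : R) (r : nat).

(* The number {n+r \brace k+r}_{r,l} is indexed by n and k (not by n+r and
   k+r). *)
Definition is_drstirling (S : nat -> nat -> R) : Prop :=
  (forall n, dfall l%:P ('X + r%:R) n
             = \sum_(k < n.+1) S n k *: fall ('X : {poly R}) k)
  /\ (forall n k, (n < k)%N -> S n k = 0).

Lemma is_drstirling_exists : {S : nat -> nat -> R | is_drstirling S}.
Proof.
pose step (n : nat) (f : nat -> R) (k : nat) : R :=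
  (if k is k'.+1 then f k' else 0) + (k%:R + r%:R - n%:R * l) * f k.
pose S := fix S (n : nat) : nat -> R :=
  if n is n'.+1 then step n' (S n') else fun k : nat => (k == 0%N)%:R.
have SE (n k : nat) : S n.+1 k = step n (S n) k by [].
have S0 (n k : nat) : (n < k)%N -> S n k = 0.
  elim: n k => [[]//|n IHn [//|k] ltnk].
  by rewrite SE /step !IHn ?mulr0 ?addr0 // ltnW.
exists S; split=> //; elim=> [|n IHn].
  by rewrite /dfall big_ord0 big_ord1 /fall big_ord0 scale1r.
rewrite /dfall big_ord_recr /= -/(dfall _ _ _) IHn mulr_suml.
rewrite (eq_bigr (fun k : 'I_n.+2 =>
    (if k : nat is k'.+1 then S n k' else 0) *: fall 'X k
    + ((k%:R + r%:R - n%:R * l) * S n k) *: fall 'X k)); last first.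
  by move=> k _; rewrite -scalerDl.
rewrite big_split /= [X in _ = X + _]big_ord_recl /= scale0r add0r.
rewrite [X in _ = _ + X]big_ord_recr /= S0 // mulr0 scale0r addr0 -big_split.
apply: eq_bigr => k _ /=; rewrite {2}/fall big_ord_recr /= -/(fall _ _).
rewrite [_ * S n k]mulrC -scalerA -scalerDr -scalerAl; congr (_ *: _).
rewrite -mul_polyC [_%:P * _]mulrC -mulrDr; congr (_ * _).
rewrite !(rmorphB, rmorphD, rmorphM) /= !rmorph_nat.
by rewrite !addrA addrNK.
Qed.

Lemma size_fall_monic k :
  fall ('X : {poly R}) k \is monic /\ size (fall ('X : {poly R}) k) = k.+1.
Proof.
rewrite /fall (eq_bigr (fun i : 'I_k => 'X - (i%:R : R)%:P)); last first.
  by move=> i _; rewrite rmorph_nat.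
by rewrite monic_prod_XsubC size_prod_XsubC /index_enum -enumT size_enum_ord.
Qed.

Lemma is_drstirling_unique S T :
  is_drstirling S -> is_drstirling T -> forall n k, S n k = T n k.
Proof.
move=> [SE S0] [TE T0] n k; case: (ltnP n k) => [ltnk|].
  by rewrite S0 ?T0.
have: \sum_(j < n.+1) (S n j - T n j) *: fall ('X : {poly R}) j = 0.
  rewrite (eq_bigr _ (fun j _ => scalerBl _ _ _)).
  by rewrite big_split sumrN /= -SE -TE subrr.
move: (n) (S n) (T n) => N s t {SE S0 TE T0}; rewrite -ltnS.
elim: N.+1 => // m IHm sum0.
have [mon sz] := size_fall_monic m.
have stm : s m = t m.
  apply/eqP; rewrite -subr_eq0; apply/eqP.
  have := congr1 (coefp m) sum0; rewrite big_ord_recr /= coefD coef0 coefZ.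
  have -> : (fall ('X : {poly R}) m)`_m = 1.
    by move/monicP: mon; rewrite lead_coefE sz.
  rewrite coef_sum big1 ?add0r ?mulr1 // => i _.
  by rewrite coefZ nth_default ?mulr0 // (size_fall_monic i).2.
rewrite ltnS leq_eqVlt => /predU1P[-> //|]; apply: IHm.
by move: sum0; rewrite big_ord_recr /= stm subrr scale0r addr0.
Qed.

Definition drstirling : nat -> nat -> R := sval is_drstirling_exists.

Lemma drstirlingP : is_drstirling drstirling.
Proof. exact: svalP. Qed.

End DegenerateRStirling.

(* Main.v *)
Require Import Defs.
From HB Require Import structures.
From mathcomp Require Import all_boot all_order all_algebra.
From mathcomp Require Import reals.
From mathcomp Require Import ring.
Import Order.TTheory GRing.Theory Num.Theory.
Local Open Scope ring_scope.

(** Expanding [(X+r+1)_{m,l}] in falling factorials of [X], via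
    [(X+1)_q = (X)_q + q (X)_{q-1}] and then via the recurrence in [m], shows
    that the coefficient of [(X)_p] is
      [S(m,p) + (p+1) S(m,p+1) = S(m+1,p+1) + (m l - r) S(m,p+1)].
    The theorem is the coefficient of [(X)_p] in the Vandermonde identity
      [(X+r)_{k,l} = sum_m C(k,m) (-1)_{k-m,l} (X+r+1)_{m,l}];
    the terms in [m l] become the second half of the summand by
    [m C(k,m) = k C(k-1,m-1)] and a shift of [m]. *)

Lemma sum_nat_widenl (A : nmodType) (F : nat -> A) p n : (p <= n)%N ->
  (forall m, (m < p)%N -> F m = 0) ->
  \sum_(p <= m < n) F m = \sum_(m < n) F m.
Proof.
move=> le_pn F0; rewrite -(big_mkord xpredT F) [RHS](@big_cat_nat _ _ _ p) //=.
by rewrite [X in _ = X + _]big_nat [X in _ = X + _]big1 ?add0r // => m /andP[_ /F0].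
Qed.

Lemma dfallS (A : comNzRingType) (l y : A) n :
  dfall l y n.+1 = dfall l y n * (y - n%:R * l).
Proof. by rewrite /dfall big_ord_recr. Qed.

Lemma dfall0 (A : comNzRingType) (l y : A) : dfall l y 0 = 1.
Proof. by rewrite /dfall big_ord0. Qed.

Lemma fallS (A : comNzRingType) (y : A) n : fall y n.+1 = fall y n * (y - n%:R).
Proof. by rewrite /fall big_ord_recr. Qed.

Lemma fall0 (A : comNzRingType) (y : A) : fall y 0 = 1.
Proof. by rewrite /fall big_ord0. Qed.

Lemma drise_dfall (A : comNzRingType) (l y : A) n :
  (-1) ^+ n * drise l y n = dfall l (- y) n.
Proof. by rewrite /drise mulrA -expr2 sqrr_sign mul1r. Qed.

(** Serves for two morphisms: composition with ['X + 1], and the embedding of constants into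
    polynomials. *)
Lemma rmorph_dfall (A B : comNzRingType) (f : {rmorphism A -> B}) (l y : A) n :
  f (dfall l y n) = dfall (f l) (f y) n.
Proof.
rewrite /dfall rmorph_prod; apply: eq_bigr => i _.
by rewrite rmorphB rmorphM rmorph_nat.
Qed.

(** Induction on [n]: the new factor splits as [x + y - n l = (x - (n - i) l) + (y - i l)], each
    half extending one of the two products, and Pascal's rule recombines the two sums. *)
Lemma dfallD (A : comNzRingType) (l x y : A) n :
  dfall l (x + y) n
  = \sum_(i < n.+1) 'C(n, i)%:R * dfall l x (n - i) * dfall l y i.
Proof.
elim: n => [|n IHn]; first by rewrite big_ord1 !dfall0 !mulr1.
rewrite dfallS IHn mulr_suml.
under eq_bigr => i _.
  have le_in : (i <= n)%N by rewrite -ltnS.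
  have -> : 'C(n, i)%:R * dfall l x (n - i) * dfall l y i
              * (x + y - n%:R * l)
    = 'C(n, i)%:R * dfall l x (n.+1 - i) * dfall l y i
      + 'C(n, i)%:R * dfall l x (n - i) * dfall l y i.+1.
    by rewrite subSn // !dfallS -[in n%:R](subnK le_in) natrD; ring.
  over.
rewrite big_split /= [RHS]big_ord_recl /=.
under [X in _ = _ + X]eq_bigr => i _.
  rewrite /bump /= add1n subSS binS natrD !mulrDl.
  over.
rewrite big_split /= addrA; congr (_ + _).
rewrite big_ord_recl /= [X in _ = _ + X]big_ord_recr /=.
rewrite (bin_small (ltnSn n)) mulr0n !mul0r addr0 !bin0.
by congr (_ + _); apply: eq_bigr => i _; rewrite /bump /= add1n subSS.
Qed.

Lemma fallD1 (A : comNzRingType) (y : A) n :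
  fall (y + 1) n.+1 = fall y n.+1 + n.+1%:R * fall y n.
Proof.
elim: n => [|n IHn]; first by rewrite !fallS !fall0; ring.
by rewrite fallS IHn !fallS; ring.
Qed.

Lemma comp_poly_fall (R : comNzRingType) (q : {poly R}) n :
  fall 'X n \Po q = fall q n.
Proof.
elim: n => [|n IHn]; first by rewrite !fall0 rmorph1.
by rewrite !fallS rmorphM /= IHn rmorphB /= comp_polyX rmorph_nat.
Qed.

Section DrStirling.
Variables (R : comNzRingType) (l : R) (r : nat).
Local Notation S := (drstirling l r).

Lemma drstirling_small n k : (n < k)%N -> S n k = 0.
Proof. exact: (drstirlingP l r).2. Qed.

(** The free bound [N] lets expansions of different degrees be compared over one range of
    indices. *)
Lemma dfall_drstirling n N : (n <= N)%N ->
  dfall l%:P ('X + r%:R) n = \sum_(k < N.+1) S n k *: fall ('X : {poly R}) k.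
Proof.
move=> le_nN; rewrite (drstirlingP l r).1.
rewrite (big_ord_widen N.+1 (fun k => S n k *: fall 'X k)) //.
rewrite big_mkcond; apply: eq_bigr => k _ /=.
by case: ltnP => // lt_nk; rewrite drstirling_small // scale0r.
Qed.

Lemma fall_free (N : nat) (c d : nat -> R) :
  \sum_(k < N.+1) c k *: fall ('X : {poly R}) k
    = \sum_(k < N.+1) d k *: fall 'X k ->
  forall k, (k <= N)%N -> c k = d k.
Proof.
move=> eq_cd k le_kN.
(* Perturbing row [N] of the Stirling numbers by [c - d] keeps their defining
   property, so uniqueness of these numbers gives [c = d]. *)
pose T n j := S n j + (if (n == N) && (j <= N)%N then c j - d j else 0).
have TP : is_drstirling l r T.
  split=> [n|n j lt_nj]; last first.
    rewrite /T drstirling_small // add0r.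
    by case: eqP => // <-; rewrite leqNgt lt_nj.
  rewrite (dfall_drstirling _ _ (leqnn n)).
  under [RHS]eq_bigr do rewrite scalerDl.
  rewrite big_split /= -[LHS]addr0; congr (_ + _).
  case: eqVneq => [->|_] /=; last by rewrite big1 // => j _; rewrite scale0r.
  under eq_bigr => j _ do rewrite -ltnS ltn_ord scalerBl.
  by rewrite sumrB eq_cd subrr.
have := is_drstirling_unique TP (drstirlingP l r) N k.
rewrite /T eqxx le_kN /= => /eqP.
by rewrite -subr_eq0 addrAC subrr add0r subr_eq0 => /eqP.
Qed.

(** Multiply the expansion of row [n] by [X + r - n l] and use [(X)_k (X + r - n l) = (X)_{k+1} + (k
    + r - n l) (X)_k]. *)
Lemma drstirlingS n p :
  S n.+1 p.+1 = S n p + (p.+1%:R + r%:R - n%:R * l) * S n p.+1.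
Proof.
have [le_pn|lt_np] := leqP p n; last first.
  by rewrite !drstirling_small ?mulr0 ?addr0 // ltnW.
pose d k := (if k is k'.+1 then S n k' else 0)
            + (k%:R + r%:R - n%:R * l) * S n k.
apply: (fall_free n.+1 (S n.+1) d) => //.
rewrite -dfall_drstirling // dfallS (dfall_drstirling _ _ (leqnSn n)) mulr_suml.
under [RHS]eq_bigr do rewrite scalerDl.
rewrite big_split /= [X in _ = X + _]big_ord_recl /= scale0r add0r.
(* The added top term is zero since [S n n.+1 = 0]; both sums now have the same range. *)
have -> : \sum_(i < n.+1) S n i *: fall ('X : {poly R}) (lift ord0 i)
          = \sum_(i < n.+2) S n i *: fall 'X i.+1.
  by rewrite [RHS]big_ord_recr /= drstirling_small // scale0r addr0.
rewrite -big_split; apply: eq_bigr => k _ /=.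
rewrite fallS -!mul_polyC !(rmorphM, rmorphB, rmorphD) /= !rmorph_nat.
by ring.
Qed.

(** Substitute [X + 1] for [X] in the expansion of [(X + r)_{n,l}]; each [(X + 1)_q] then
    contributes to the coefficients of [(X)_q] and [(X)_{q-1}]. *)
Lemma dfall_drstirlingD1 n N : (n <= N)%N ->
  dfall l%:P ('X + r%:R + 1) n
  = \sum_(p < N.+1) (S n p + p.+1%:R * S n p.+1) *: fall ('X : {poly R}) p.
Proof.
move=> le_nN.
have -> : dfall l%:P ('X + r%:R + 1) n
          = dfall l%:P ('X + r%:R) n \Po ('X + 1).
  rewrite (rmorph_dfall _ _ (comp_poly ('X + 1))) /= comp_polyC.
  by rewrite rmorphD /= comp_polyX rmorph_nat addrAC.
rewrite (dfall_drstirling _ _ le_nN) raddf_sum /=.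
under eq_bigr do rewrite comp_polyZ comp_poly_fall.
under [RHS]eq_bigr do rewrite scalerDl.
rewrite big_split /= [X in _ = _ + X]big_ord_recr /=.
rewrite drstirling_small ?ltnS // mulr0 scale0r addr0.
rewrite big_ord_recl [X in _ = X + _]big_ord_recl /= !fall0 -addrA.
congr (_ + _); rewrite -big_split; apply: eq_bigr => k _ /=.
rewrite /bump /= add1n fallD1 scalerDr; congr (_ + _).
by rewrite -!mul_polyC rmorphM /= rmorph_nat; ring.
Qed.

Lemma drstirling_binomial k p : (p <= k)%N ->
  S k p = \sum_(m < k.+1) 'C(k, m)%:R * dfall l (- 1) (k - m)
            * (S m p + p.+1%:R * S m p.+1).
Proof.
move=> le_pk.
apply: (fall_free k (S k) (fun p => \sum_(m < k.+1) 'C(k, m)%:R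
  * dfall l (- 1) (k - m) * (S m p + p.+1%:R * S m p.+1))) => //.
rewrite -dfall_drstirling //.
have -> : ('X + r%:R : {poly R}) = - 1 + ('X + r%:R + 1) by ring.
rewrite dfallD.
under [RHS]eq_bigr do rewrite scaler_suml.
rewrite exchange_big; apply: eq_bigr => m _ /=.
rewrite (dfall_drstirlingD1 m k) -1?ltnS // mulr_sumr.
apply: eq_bigr => j _; rewrite -[RHS]scalerA -[RHS]mul_polyC rmorphM /=.
by rewrite rmorph_nat (rmorph_dfall _ _ polyC) rmorphN rmorph1.
Qed.

End DrStirling.

Theorem theorem9 (R : realType) (l : R) (r : nat) (p k : nat) (hpk : (p <= k)%N) :
  drstirling l r k p =
  \sum_(p <= m < k.+1)
     ('C(k, m)%:R * (-1) ^+ (k - m) * drise l 1 (k - m)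
        * (drstirling l r m.+1 p.+1 - r%:R * drstirling l r m p.+1)
      + l * k%:R * 'C(k - 1, m)%:R * (-1) ^+ (k - m - 1) * drise l 1 (k - m - 1)
        * drstirling l r m.+1 p.+1).
Proof.
(* For [m < p] both Stirling numbers in the summand vanish, so the sum may start at 0. *)
rewrite sum_nat_widenl ?leqW // => [|m lt_mp]; last first.
  by rewrite /= !drstirling_small // ?ltnS ?(ltnW lt_mp) // !mulr0 subrr mulr0 addr0.
rewrite (drstirling_binomial _ _ _ _ _ hpk).
(* [G] collects the terms in [m l] produced by the recurrence [drstirlingS]. *)
pose G m := 'C(k, m)%:R * dfall l (- 1) (k - m) * m%:R * l
            * drstirling l r m p.+1.
transitivity (\sum_(m < k.+1) ('C(k, m)%:R * dfall l (- 1) (k - m)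
    * (drstirling l r m.+1 p.+1 - r%:R * drstirling l r m p.+1) + G m)).
  by apply: eq_bigr => m _; rewrite drstirlingS /G; ring.
rewrite !big_split /=; congr (_ + _).
  by apply: eq_bigr => m _; rewrite -drise_dfall; ring.
(* To shift the index, drop [m = 0] on the left, killed by the factor [m], and isolate [m = k] on
   the right. *)
rewrite big_ord_recl [RHS]big_ord_recr /= /G mulr0 !mul0r add0r.
(* For [k = 0] truncated subtraction makes the binomial ['C(0, 0) = 1], and the factor [k] kills the
   isolated term; for positive [k] the binomial ['C(k - 1, k)] does. *)
case: k {hpk G} => [|k]; first by rewrite !big_ord0 !(mulr0, mul0r) addr0.
rewrite subn1 /= (bin_small (ltnSn k)) mulr0n !(mulr0, mul0r) addr0.
apply: eq_bigr => m _; rewrite /bump /= add1n -subnDA addn1 subSS -drise_dfall.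
have bin_diag : 'C(k.+1, m.+1)%:R * m.+1%:R = k.+1%:R * 'C(k, m)%:R :> R.
  by rewrite -!natrM mulnC -mul_bin_diag.
rewrite -[in RHS]mulrA -[l * _ * _]mulrA -bin_diag; ring.
Qed.
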